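(* Let $2\le d=o(\log n)$, $\delta:=e/3$ and $r:=O(\log\log n)$. Consider streams of triples $\{(q_i,k_i,v_i)\}_{i=1}^n$ in $\mathbb{R}^d$ such that $\|k_i\|_2\le 1$ and $\|q_i\|_2\le r$ for all $i\in[n]$. Then the SubGen algorithm uses $\widetilde{O}(de^d)$ bits of space and outputs an estimate $\widehat{O}_n$ such that with probability at least $0.99$ $$\|\widehat{O}_n-\operatorname{Attn}(q_n,K_n,V_n)\|_2\le\varepsilon\cdot\|\operatorname{softmax}(K_n\cdot q_n)\|_2\cdot\|V_n\|_2 .$$
   Context: $K_n$ and $V_n$ are the $n\times d$ matrices whose rows are $k_1^T,\dots,k_n^T$ and $v_1^T,\dots,v_n^T$. The attention function is $\operatorname{Attn}(q_n,K_n,V_n):=\operatorname{softmax}(K_nq_n)^TV_n=\sum_{\ell=1}^n\frac{e^{q_n^Tk_\ell}}{\sum_{m=1}^ne^{q_n^Tk_m}}v_\ell\in\mathbb{R}^d$. The stream is processed in one pass and space is the number of bits of memory. $\widetilde{O}(\cdot)$ suppresses factors polylogarithmic in $n$ and the dependence on the accuracy parameter $\varepsilon>0$. Clusterability: for a positive integer $m$ and real $\delta>0$, points $x_1,\dots,x_n\in\mathbb{R}^d$ are $(m,\delta)$-clusterable if there is a partition of them into $m$ clusters $C_1,\dots,C_m$ such that $\|x-y\|_2\le\delta$ for all $i\in[m]$ and $x,y\in C_i$. SubGen (known algorithm of Zandieh et al., with the following known guarantee): if the input is a stream $\{(q_i,k_i,v_i)\}_{i=1}^n$ in $\mathbb{R}^d$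 whose keys $k_i$ are $(m,\delta)$-clusterable and $\|q_i\|_2\le r$ for all $i\in[n]$, then SubGen is a streaming algorithm that uses $O(d\varepsilon^{-2}\cdot(d+me^{2\delta r}\log n))$ bits of space and outputs an estimate $\widehat{O}_n$ such that with probability at least $0.99$, $\|\widehat{O}_n-\operatorname{Attn}(q_n,K_n,V_n)\|_2\le\varepsilon\|\operatorname{softmax}(K_nq_n)\|_2\|V_n\|_2$. *)

(* Defs.v *)
(* MathComp-Analysis; R : realType stands for the real numbers. *)
From HB Require Import structures.
From mathcomp Require Export all_boot all_order all_algebra.
From mathcomp Require Export all_classical all_reals all_analysis.
Export Order.TTheory GRing.Theory Num.Theory.
Export numFieldNormedType.Exports.

Set Implicit Arguments.
Unset Strict Implicit.
Unset Printing Implicit Defensive.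

Local Open Scope classical_set_scope.
Local Open Scope ring_scope.

(* The norm that MathComp-Analysis puts on matrices is the max norm, hence
   the following Euclidean norm. *)
Definition l2norm (R : realType) (d : nat) (x : 'cV[R]_d) : R :=
  Num.sqrt (\sum_(i < d) x i 0 ^+ 2).

(* Spectral norm: for a matrix, [||A||_2] is the norm induced by the Euclidean
   norms. *)
Definition mxnorm2 (R : realType) (n d : nat) (A : 'M[R]_(n, d)) : R :=
  sup [set l2norm (A *m x) | x in [set x : 'cV[R]_d | l2norm x <= 1]].

Definition softmax (R : realType) (n : nat) (x : 'cV[R]_n) : 'cV[R]_n :=
  \col_(i < n) (expR (x i 0) / \sum_(j < n) expR (x j 0)).

Definition Attn (R : realType) (n d : nat)
    (q : 'cV[R]_d) (K V : 'M[R]_(n, d)) : 'cV[R]_d :=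
  ((softmax (K *m q))^T *m V)^T.

Record token (R : realType) (d : nat) := Token {
  query : 'cV[R]_d;
  key : 'cV[R]_d;
  value : 'cV[R]_d }.

Section Stream.
Variables (R : realType) (n d : nat) (s : n.-tuple (token R d)).

Definition keys_mx : 'M[R]_(n, d) := \matrix_(i, j) key (tnth s i) j 0.

Definition values_mx : 'M[R]_(n, d) := \matrix_(i, j) value (tnth s i) j 0.

(* The query [q_n] of the last token; the default token is only returned on
   the empty stream. *)
Definition last_query : 'cV[R]_d := query (last (Token 0 0 0) s).

End Stream.

(* Clusters are sets of indices, so that points occurring several times in the
   stream need no special treatment. The blocks of a [partition] are
   nonempty. *)
Definition clusterable (R : realType) (n d m : nat) (delta : R)
    (x : 'I_n -> 'cV[R]_d) : Prop :=
  exists P : {set {set 'I_n}},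
    [/\ finset.partition P [set: 'I_n]%SET, #|P| = m &
        forall C : {set 'I_n}, C \in P ->
        forall i j, i \in C -> j \in C -> l2norm (x i - x j) <= delta].

(* A randomized one-pass algorithm: a random seed drawn from a probability
   space, and, for each seed, a deterministic machine that reads the tokens one
   by one. The memory is a finite list of cells, and its size in bits is the
   total size of these cells. Leaving the type of cells open covers memories
   made of single bits ([cell := bool], [cell_bits := fun=> 1]) as well as
   memories made of real numbers kept in words of a fixed length ([cell := R],
   [cell_bits] constant); with inputs ranging over the whole of R^d, the bounds
   below, which do not involve the magnitude of the inputs, presuppose the
   latter convention. The estimate may depend on the query being answered. *)
Record streaming_alg (R : realType) (d : nat) := StreamingAlg {
  cell : Type;
  cell_bits : cell -> nat;
  cell_bits_gt0 : forall c, (0 < cell_bits c)%N;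
  seed_display : measure_display;
  seed : measurableType seed_display;
  seed_law : probability seed R;
  init : seed -> seq cell;
  update : seed -> seq cell -> token R d -> seq cell;
  estimate : seed -> seq cell -> 'cV[R]_d -> 'cV[R]_d }.

Section Run.
Variables (R : realType) (d : nat) (A : streaming_alg R d).

Definition memory (w : seed A) (s : seq (token R d)) : seq (cell A) :=
  foldl (update w) (init w) s.

Definition memory_bits (c : seq (cell A)) : nat :=
  (\sum_(x <- c) cell_bits x)%N.

(* Worst case over the seeds and over the successive memory states. *)
Definition uses_space (s : seq (token R d)) (B : R) : Prop :=
  forall (w : seed A) (i : nat), (i <= size s)%N ->
    (memory_bits (memory w (take i s)))%:R <= B.

Definition output (n : nat) (s : n.-tuple (token R d)) (w : seed A) :
    'cV[R]_d :=
  estimate w (memory w s) (last_query s).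

Definition accurate_event (n : nat) (s : n.-tuple (token R d)) (eps : R) :
    set (seed A) :=
  [set w | l2norm (output s w
                   - Attn (last_query s) (keys_mx s) (values_mx s))
           <= eps * l2norm (softmax (keys_mx s *m last_query s))
                  * mxnorm2 (values_mx s)].

Definition accurate (n : nat) (s : n.-tuple (token R d)) (eps : R) : Prop :=
  measurable (accurate_event s eps) /\
  ((99 / 100)%:E <= seed_law A (accurate_event s eps))%E.

End Run.

(* An instance of the algorithm is determined by the length [n] and dimension
   [d] of the stream, the accuracy [eps], the cluster diameter [delta] and the
   bound [r] on the queries; the number of clusters [m] is not known to it. *)
Definition alg_family (R : realType) : Type :=
  forall (n d : nat) (eps delta r : R), streaming_alg R d.

Definition SubGen_guarantee (R : realType) (SubGen : alg_family R) : Prop :=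
  exists C : R, forall (n d m : nat) (eps delta r : R)
      (s : n.-tuple (token R d)),
    (0 < n)%N -> (0 < d)%N -> (0 < m)%N -> 0 < eps -> 0 < delta ->
    clusterable m delta (fun i => key (tnth s i)) ->
    (forall i, l2norm (query (tnth s i)) <= r) ->
    uses_space (SubGen n d eps delta r) s
      (C * (d%:R * eps ^- 2 *
            (d%:R + m%:R * expR (2 * delta * r) * ln n%:R))) /\
    accurate (SubGen n d eps delta r) s eps.

Definition admissible (R : realType) (n d : nat) (r : R)
    (s : n.-tuple (token R d)) : Prop :=
  forall i, l2norm (key (tnth s i)) <= 1 /\ l2norm (query (tnth s i)) <= r.

(* Main.v *)
(* Everything reduces to covering the keys by few sets of diameter at most e/3:
   if m <= 2 e^d ln n + 1 clusters suffice, the space bound of the guarantee is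
   polylogarithmic times d e^d, because e^(2 delta r) is a power of ln n.

   The usual volumetric bound on covering numbers of the unit ball is too weak
   for e^d. Instead, take centers c uniformly distributed in the ball of radius
   R = 1.1 > sqrt(1 + 0.44^2). If |x| <= 1, the half of the ball B(x, 0.44)
   that faces the origin lies in B(0, R), since |x + u|^2 <= |x|^2 + |u|^2 when
   x.u <= 0; hence c is within 0.44 of x with probability at least
   (1/2)(0.44/R)^d = (1/2)(5/2)^-d. Finitely many points that are all close to
   a random center with probability at least p are covered greedily by
   ln n / p + 1 balls, as each new ball can be chosen to cover a fraction p of
   what is left.

   Volumes are replaced by counts of points of a fine grid, with 5/2 weakened
   to 13/5 (still less than e) to absorb the rounding errors. *)
Require Import Defs.
From mathcomp Require Import ring lra zify.

Set Implicit Arguments.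
Unset Strict Implicit.
Unset Printing Implicit Defensive.

Local Open Scope classical_set_scope.
Local Open Scope ring_scope.

(** * Euclidean norm of column vectors *)

Section EuclideanNorm.
Variables (R : realType) (d : nat).
Implicit Types x y : 'cV[R]_d.

Lemma l2norm_ge0 x : 0 <= l2norm x.
Proof. exact: sqrtr_ge0. Qed.

Lemma sqr_l2norm x : l2norm x ^+ 2 = \sum_i x i 0 ^+ 2.
Proof. by rewrite sqr_sqrtr // sumr_ge0 // => i _; exact: sqr_ge0. Qed.

Lemma sqr_l2normD x y :
  l2norm (x + y) ^+ 2
  = l2norm x ^+ 2 + l2norm y ^+ 2 + 2 * \sum_i x i 0 * y i 0.
Proof.
rewrite !sqr_l2norm mulr_sumr -!big_split /=.
by apply: eq_bigr => i _; rewrite mxE; ring.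
Qed.

Lemma l2normZ a x : l2norm (a *: x) = `|a| * l2norm x.
Proof.
rewrite /l2norm -sqrtr_sqr -sqrtrM ?sqr_ge0// mulr_sumr.
by congr Num.sqrt; apply: eq_bigr => i _; rewrite mxE exprMn.
Qed.

Lemma l2normN x : l2norm (- x) = l2norm x.
Proof. by rewrite -scaleN1r l2normZ normrN1 mul1r. Qed.

Lemma cauchy_schwarz x y : \sum_i x i 0 * y i 0 <= l2norm x * l2norm y.
Proof.
set S := \sum_i _; set a := l2norm x; set b := l2norm y.
have a0 : 0 <= a := l2norm_ge0 x.
have b0 : 0 <= b := l2norm_ge0 y.
(* Expand the square of the norm of [b *: x - a *: y]. Cancelling [a * b] needs it positive;
   otherwise one vector is zero and [S = 0]. *)
have le_ab : a * b * S <= (a * b) ^+ 2.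
  have := sqr_ge0 (l2norm (b *: x - a *: y)).
  rewrite sqr_l2normD l2normN !l2normZ !ger0_norm // -/a -/b.
  have -> : \sum_i (b *: x) i 0 * (- (a *: y)) i 0 = - (a * b * S).
    rewrite mulr_sumr -sumrN; apply: eq_bigr => i _; rewrite !mxE; ring.
  rewrite !exprMn; nra.
have [ab0|ab0] := ltP 0 (a * b).
  by rewrite -(ler_pM2l ab0) -expr2.
have coord0 (z : 'cV[R]_d) : l2norm z = 0 -> forall i, z i 0 = 0.
  move=> z0 i; have /eqP := sqr_l2norm z.
  rewrite z0 expr0n /= eq_sym psumr_eq0 => [|j _]; last exact: sqr_ge0.
  by move=> /allP/(_ i (mem_index_enum _)); rewrite sqrf_eq0 => /eqP.
have /eqP : a * b = 0 by apply/eqP; rewrite eq_le ab0 mulr_ge0.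
rewrite mulf_eq0 => /orP[] /eqP /coord0 z0.
  by rewrite /S big1 ?mulr_ge0 // => i _; rewrite z0 mul0r.
by rewrite /S big1 ?mulr_ge0 // => i _; rewrite z0 mulr0.
Qed.

Lemma l2normD x y : l2norm (x + y) <= l2norm x + l2norm y.
Proof.
rewrite -(ler_pXn2r (ltn0Sn 1)) ?nnegrE ?addr_ge0 ?l2norm_ge0 //.
rewrite sqr_l2normD; have := cauchy_schwarz x y; nra.
Qed.

Lemma normr_le_l2norm x i : `|x i 0| <= l2norm x.
Proof.
rewrite -sqrtr_sqr ler_sqrt; last first.
  by apply: sumr_ge0 => j _; exact: sqr_ge0.
by rewrite (bigD1 i) //= lerDl; apply: sumr_ge0 => j _; exact: sqr_ge0.
Qed.

(** The factor [d], cruder than its square root, avoids roots; it is why the mesh is of order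
    [1 / d]. *)
Lemma l2norm_le_sup x (b : R) :
  0 <= b -> (forall i, `|x i 0| <= b) -> l2norm x <= d%:R * b.
Proof.
move=> b0 xb; rewrite -(ler_pXn2r (ltn0Sn 1)) ?nnegrE ?mulr_ge0 ?l2norm_ge0 //.
rewrite sqr_l2norm; apply: (@le_trans _ _ (\sum_(i < d) b ^+ 2)).
  by apply: ler_sum => i _; rewrite -real_normK ?num_real // lerXn2r ?nnegrE.
rewrite sumr_const card_ord exprMn -[leLHS]mulr_natl ler_wpM2r ?sqr_ge0 //.
by rewrite -natrX ler_nat; case: (d) => // k; rewrite leq_pmulr.
Qed.

End EuclideanNorm.

(** * Greedy covering and the resulting partition *)

Section GreedyCover.
Variables (R : realType) (I G : finType) (Y : {set G}) (cov : G -> {set I}).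
Variable p : R.
Hypotheses (p_gt0 : 0 < p) (p_le1 : p <= 1) (Y_gt0 : (0 < #|Y|)%N).
Hypothesis cov_dense : forall i,
  p * #|Y|%:R <= #|[set g in Y | i \in cov g]%SET|%:R.

(** Averaging: counting the pairs of [g] in [Y] and [i] in [U] covered by [g] in two ways, the mean
    over [g] is at least [p * #|U|]. *)
Lemma exists_dense_cover (U : {set I}) :
  exists g, p * #|U|%:R <= #|(U :&: cov g)%SET|%:R.
Proof.
apply: contrapT => no_g.
have lt_g g : #|(U :&: cov g)%SET|%:R < p * #|U|%:R.
  by rewrite ltNge; apply/negP => h; apply: no_g; exists g.
have double_count : (\sum_(g in Y) #|(U :&: cov g)%SET| =
    \sum_(i in U) #|[set g in Y | i \in cov g]%SET|)%N.
  under eq_bigr => g _ do rewrite -sum1_card.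
  under [RHS]eq_bigr => g _ do rewrite -sum1_card.
  rewrite (exchange_big_dep (mem U)) /= => [|g i _]; last first.
    by rewrite inE => /andP[].
  apply: eq_bigr => i iU; apply: eq_bigl => g.
  by rewrite !inE iU.
have : (\sum_(g in Y) #|(U :&: cov g)%SET|%:R : R) < \sum_(g in Y) p * #|U|%:R.
  have [g gY] := card_gt0P Y_gt0.
  rewrite (bigD1 g) //= [ltRHS](bigD1 g) //= ltr_leD //.
  by apply: ler_sum => h _; exact: ltW.
have -> : \sum_(g in Y) p * #|U|%:R = \sum_(i in U) p * #|Y|%:R :> R.
  by rewrite !sumr_const -[LHS]mulr_natr -[RHS]mulr_natr mulrAC.
rewrite -natr_sum double_count natr_sum ltNge => /negP; apply.
by apply: ler_sum => i _; exact: cov_dense.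
Qed.

Lemma greedy_cover (N : nat) : exists s : seq G, size s = N /\
  #|[set i | ~~ has (fun g => i \in cov g) s]%SET|%:R <= (1 - p) ^+ N * #|I|%:R.
Proof.
elim: N => [|N [s [sN sU]]].
  by exists [::]; rewrite expr0 mul1r ler_nat max_card.
set U := [set i | _]%SET in sU.
have [g gU] := exists_dense_cover U.
exists (g :: s); split; first by rewrite /= sN.
have -> : [set i | ~~ has (fun g => i \in cov g) (g :: s)]%SET
          = (U :\: cov g)%SET.
  by apply/setP => i; rewrite !inE /= negb_or.
have UE : #|(U :&: cov g)%SET|%:R + #|(U :\: cov g)%SET|%:R = #|U|%:R :> R.
  by rewrite -natrD cardsID.
rewrite exprS -mulrA; apply: (@le_trans _ _ ((1 - p) * #|U|%:R)).
  by rewrite mulrBl mul1r -UE lerBrDl lerD2r UE.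
by rewrite ler_wpM2l // subr_ge0.
Qed.

(** As [1 - p <= expR (- p)], after [N > ln #|I| / p] greedy steps fewer than one point is left. *)
Lemma greedy_partition : (0 < #|I|)%N -> exists P : {set {set I}},
  [/\ finset.partition P [set: I]%SET,
      #|P|%:R <= ln #|I|%:R / p + 1 &
      forall C, C \in P -> exists g, C \subset cov g].
Proof.
move=> I_gt0; pose N := (Num.truncn (ln (#|I|%:R : R) / p)).+1.
have I_gt0R : 0 < #|I|%:R :> R by rewrite ltr0n.
have lnI0 : 0 <= ln (#|I|%:R : R) by rewrite ln_ge0 // ler1n.
have /andP[N_le N_gt] : N.-1%:R <= ln (#|I|%:R : R) / p < N%:R.
  by apply: truncn_itv; rewrite divr_ge0 // ltW.
have [s [sN sU]] := greedy_cover N.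
have all_cov i : has (fun g => i \in cov g) s.
  suff /eqP : #|[set i | ~~ has (fun g => i \in cov g) s]%SET| == 0%N.
    by move/cards0_eq/setP/(_ i); rewrite !inE => /negbFE.
  rewrite -leqn0 -ltnS -(ltr_nat R); apply: le_lt_trans sU _.
  apply: (@le_lt_trans _ _ (expR (- p) ^+ N * #|I|%:R)).
    rewrite ler_wpM2r // lerXn2r ?nnegrE ?subr_ge0 ?expR_ge0 //.
    exact: expR_ge1Dx.
  have -> : #|I|%:R = expR (ln (#|I|%:R : R)) by rewrite lnK.
  rewrite -expRM_natl -expRD -[ltRHS]expR0 ltr_expR mulrN.
  by move: N_gt; rewrite ltr_pdivrMr // addrC subr_lt0.
(* Each point goes to the first set containing it, which makes overlapping sets into disjoint
   blocks. *)
pose f i := find (fun g => i \in cov g) s.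
exists (preim_partition f [set: I]%SET); split.
- exact: preim_partitionP.
- apply: (@le_trans _ _ N%:R); last by rewrite /N -natr1 lerD2r.
  rewrite ler_nat -[leqRHS]card_ord.
  apply: leq_trans (leq_imset_card (fun k : 'I_N => [set i | f i == k]%SET) _).
  apply/subset_leq_card/fintype.subsetP => C /imsetP[i _ ->].
  have fiN : (f i < N)%N by rewrite -sN -has_find.
  apply/imsetP; exists (Ordinal fiN) => //.
  by apply/setP => j; rewrite !inE eq_sym.
- move=> C /imsetP[i _ ->]; have [g0 _ _] := hasP (all_cov i).
  exists (nth g0 s (f i)); apply/fintype.subsetP => j.
  rewrite !inE /= => /eqP ->.
  exact: (nth_find g0 (all_cov j)).
Qed.

End GreedyCover.

(** * Grid centers in the ball of radius [L / M = 1.1] *)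

(* [L] and [M] are variables with known values, rather than definitions, to keep
   their large unary values out of conversion checks. The mesh is [M^-1]. *)
Section Grid.
Variables (R : realType) (d L : nat) (M : R).
Hypotheses (d_gt0 : (0 < d)%N) (LE : L%:R = 220 * d%:R :> R)
  (ME : M = 200 * d%:R).

Let grid := {ffun 'I_d -> 'I_(2 * L).+1}.
(** The shift by [L] makes [grid] the integer cube of coordinates from [- L] to [L]. *)
Let coord (g : grid) (i : 'I_d) : int := (g i)%:Z - L%:Z.
Let of_coord (v : 'I_d -> int) : grid := [ffun i => inord `|(v i + L%:Z)%R|%N].
Let vec (v : 'I_d -> int) : 'cV[R]_d := \col_i (v i)%:~R.

Let coordK : cancel coord of_coord.
Proof.
move=> g; apply/ffunP => i; rewrite ffunE; apply: val_inj.
by rewrite /coord subrK /= inordK.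
Qed.

Let of_coordK (v : 'I_d -> int) :
  l2norm (vec v) <= L%:R -> coord (of_coord v) =1 v.
Proof.
move=> vL i; have := le_trans (normr_le_l2norm (vec v) i) vL.
rewrite mxE -intr_norm [L%:R]pmulrn ler_int /coord ffunE => vi.
by rewrite inordK; lia.
Qed.

Let ball_grid : {set grid} := [set g | l2norm (vec (coord g)) <= L%:R]%SET.
Let center (g : grid) : 'cV[R]_d := M^-1 *: vec (coord g).

Section OnePoint.
Variables (x : 'cV[R]_d) (x_le1 : l2norm x <= 1).

(* Every digit vector [5 k + t] is also [13 l + s]. The map sending [(k, t)] to
   [(y, s)] and a sign, where [y] is the grid point next to [x] translated by
   [l] or [- l], whichever points towards the origin, is injective; it plays
   the role of the scaling by [5 / 13] in the comparison of volumes. *)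
Let anchor i : int := Num.floor (M * x i 0).
Let digits (kt : grid * {ffun 'I_d -> 'I_5}) i : int :=
  5 * coord kt.1 i + (kt.2 i)%:Z.
Let shrunk kt i : int := (digits kt i %/ 13)%Z.
Let outward kt : bool := 0 < \sum_i vec anchor i 0 * vec (shrunk kt) i 0.
Let shifted kt i : int := anchor i + (-1) ^+ outward kt * shrunk kt i.
Let code kt : (grid * {ffun 'I_d -> 'I_13}) * bool :=
  (of_coord (shifted kt), [ffun i => inord `|(digits kt i %% 13)%Z|%N],
   outward kt).

Let DR_gt0 : 0 < d%:R :> R. Proof. by rewrite ltr0n. Qed.

Let M_gt0 : 0 < M. Proof. by rewrite ME mulr_gt0. Qed.

(** Scaling [220 d] by [5 / 13] gives less than [85 d]; rounding moves each coordinate by at most 1,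
    hence the vector by at most [d]. *)
Let l2norm_shrunk kt : kt.1 \in ball_grid ->
  l2norm (vec (shrunk kt)) <= 86 * d%:R.
Proof.
rewrite inE => kL; set u := vec _.
have -> : u = (5 / 13) *: vec (coord kt.1) + (u - (5 / 13) *: vec (coord kt.1)).
  by rewrite addrC subrK.
apply: le_trans (l2normD _ _) _; rewrite l2normZ ger0_norm; last lra.
have : l2norm (u - (5 / 13) *: vec (coord kt.1)) <= d%:R * 1.
  apply: l2norm_le_sup => // i; rewrite !mxE /shrunk.
  set q := (_ %/ _)%Z.
  (* The difference is [t - s] with [0 <= t < 5] and [0 <= s < 13]. *)
  have : `|13 * q - 5 * coord kt.1 i| <= 13.
    have := divz_eq (digits kt i) 13; rewrite -/q => dE.
    have : 0 <= (digits kt i %% 13)%Z < 13 by rewrite modz_ge0 // ltz_pmod.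
    have := ltn_ord (kt.2 i); move: dE; rewrite {1}/digits.
    move: (modz _ _) (coord _ _) (nat_of_ord _) => s k t.
    by rewrite ler_norml => ? ? /andP[? ?]; apply/andP; split; lia.
  rewrite -(ler_int R) intr_norm intrB !intrM !ler_norml => /andP[? ?].
  by apply/andP; split; lra.
by move: kL DR_gt0; rewrite LE; lra.
Qed.

Let l2norm_anchor : l2norm (vec anchor - M *: x) <= d%:R.
Proof.
rewrite -[leRHS]mulr1; apply: l2norm_le_sup => // i; rewrite !mxE /anchor.
have /andP[] := floor_itv (M * x i 0); rewrite intrD => ? ?.
by rewrite ler_norml; apply/andP; split; lra.
Qed.

Let vec_shifted kt :
  vec (shifted kt) = vec anchor + (-1) ^+ outward kt *: vec (shrunk kt).
Proof.
by apply/matrixP => i j; rewrite !mxE intrD intrM rmorphXn /= rmorphN1.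
Qed.

Let l2norm_sign (b : bool) (u : 'cV[R]_d) : l2norm ((-1) ^+ b *: u) = l2norm u.
Proof. by rewrite l2normZ normrX normrN1 expr1n mul1r. Qed.

(** The sign makes the inner product nonpositive, and [201 ^ 2 + 86 ^ 2 <= 220 ^ 2]. *)
Let shifted_ball kt : kt.1 \in ball_grid -> l2norm (vec (shifted kt)) <= L%:R.
Proof.
move=> kL; rewrite -(ler_pXn2r (ltn0Sn 1)) ?nnegrE ?l2norm_ge0 //.
rewrite vec_shifted sqr_l2normD l2norm_sign.
have dot_le0 : \sum_i vec anchor i 0
    * ((-1) ^+ outward kt *: vec (shrunk kt)) i 0 <= 0.
  under eq_bigr => i _ do rewrite [X in _ * X]mxE mulrCA.
  rewrite -mulr_sumr /outward; case: ltP; rewrite ?expr1 ?expr0; lra.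
have anchor_le : l2norm (vec anchor) <= 201 * d%:R.
  rewrite -[vec anchor](subrK (M *: x)).
  apply: le_trans (l2normD _ _) _; rewrite l2normZ (gtr0_norm M_gt0).
  apply: (@le_trans _ _ (d%:R + M)); last by rewrite ME; lra.
  apply: lerD; first exact: l2norm_anchor.
  by rewrite ler_piMr // ltW.
have anchor_ge0 := l2norm_ge0 (vec anchor).
have shrunk_le := l2norm_shrunk kL.
have shrunk_ge0 := l2norm_ge0 (vec (shrunk kt)).
rewrite LE; move: anchor_le shrunk_le anchor_ge0 shrunk_ge0 dot_le0.
move: (l2norm _) (l2norm _) (\sum_i _) => b a c ? ? a0 b0 c0.
have h1 : a ^+ 2 <= (201 * d%:R) ^+ 2.
  by rewrite lerXn2r ?nnegrE ?mulr_ge0.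
have h2 : b ^+ 2 <= (86 * d%:R) ^+ 2.
  by rewrite lerXn2r ?nnegrE ?mulr_ge0.
have := sqr_ge0 (d%:R : R); move: h1 h2; rewrite !exprMn; lra.
Qed.

(** The translation costs [86 d] and the rounding of [M *: x] costs [d]; divided by [M = 200 d] this
    is [0.435]. *)
Let near_center kt : kt.1 \in ball_grid ->
  l2norm (x - center (of_coord (shifted kt))) <= 44 / 100.
Proof.
move=> kL.
have -> : x - center (of_coord (shifted kt))
    = M^-1 *: - (vec (shifted kt) - M *: x).
  rewrite opprB scalerBr scalerA mulVf ?lt0r_neq0 // scale1r /center.
  congr (_ - _ *: _); apply/matrixP => i j.
  by rewrite !mxE of_coordK // shifted_ball.
rewrite l2normZ l2normN gtr0_norm ?invr_gt0 //.
rewrite ler_pdivrMl // vec_shifted addrAC.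
apply: le_trans (l2normD _ _) _; rewrite l2norm_sign.
have := l2norm_anchor; have := l2norm_shrunk kL; rewrite ME.
by move: (l2norm _) (l2norm _) DR_gt0 => a b; lra.
Qed.

(** The shifted point and the sign give back the quotients by 13; with the remainders they give
    [5 k + t], and [0 <= t < 5] separates [k] from [t]. *)
Let code_inj : {in finset.setX ball_grid [set: {ffun 'I_d -> 'I_5}]%SET &,
  injective code}.
Proof.
case=> k t [k' t'] /finset.setXP[kL _] /finset.setXP[k'L _].
set kt := (k, t); set kt' := (k', t') => -[eq_shifted eq_rem eq_out].
have digitsE i : digits kt i = digits kt' i.
  have : shifted kt i = shifted kt' i.
    by rewrite -of_coordK ?shifted_ball // eq_shifted of_coordK ?shifted_ball.
  rewrite /shifted eq_out => /addrI/(can_inj (signrMK _)) eq_shrunk.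
  have eq_mod : (digits kt i %% 13)%Z = (digits kt' i %% 13)%Z.
    have /(congr1 val) : inord `|(digits kt i %% 13)%Z|
        = inord `|(digits kt' i %% 13)%Z| :> 'I_13.
      by move/ffunP/(_ i): eq_rem; rewrite !ffunE.
    have := modz_ge0 (digits kt i) (isT : (13 : int) != 0).
    have := modz_ge0 (digits kt' i) (isT : (13 : int) != 0).
    have := ltz_pmod (digits kt i) (isT : (0 : int) < 13).
    have := ltz_pmod (digits kt' i) (isT : (0 : int) < 13).
    move: (modz _ _) (modz _ _) => s s' ? ? ? ?.
    by rewrite /= !inordK; lia.
  have := divz_eq (digits kt i) 13; rewrite eq_mod => dE.
  apply: etrans dE (esym _); rewrite -/(shrunk kt i) eq_shrunk.
  exact: divz_eq.
have coordE i : coord k i = coord k' i /\ t i = t' i :> nat.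
  have := digitsE i; rewrite /digits.
  by have := ltn_ord (t i); have := ltn_ord (t' i); rewrite /=; lia.
congr pair.
  by apply: (can_inj coordK); apply/funext => i; case: (coordE i).
by apply/ffunP => i; apply: val_inj; case: (coordE i).
Qed.

(** [code] injects the pairs [(k, t)] into triples of a near grid point, a remainder vector
    ([13 ^ d] choices) and a sign. *)
Lemma card_near_center :
  (5 ^ d * #|ball_grid| <= 2 * 13 ^ d *
     #|[set g in ball_grid | (l2norm (x - center g) <= 44 / 100)%R]%SET|)%N.
Proof.
have -> : (5 ^ d * #|ball_grid| =
    #|finset.setX ball_grid [set: {ffun 'I_d -> 'I_5}]%SET|)%N.
  by rewrite cardsX cardsT card_ffun !card_ord mulnC.
rewrite -(card_in_imset code_inj); set near := [set g in _ | _]%SET.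
have -> : (2 * 13 ^ d * #|near| =
    #|finset.setX (finset.setX near [set: {ffun 'I_d -> 'I_13}])
        [set: bool]|%SET)%N.
  by rewrite !cardsX !cardsT card_ffun !card_ord card_bool; lia.
apply/subset_leq_card/fintype.subsetP => y.
move=> /imsetP[[k t] /finset.setXP[kL _] ->].
rewrite !finset.in_setX !finset.in_setT !andbT !inE near_center // andbT.
rewrite (_ : coord _ = shifted (k, t)) ?shifted_ball //.
by apply/funext => i; rewrite of_coordK ?shifted_ball.
Qed.

End OnePoint.

Lemma ball_grid_gt0 : (0 < #|ball_grid|)%N.
Proof.
have zeroL : l2norm (vec (fun=> 0)) <= L%:R.
  by rewrite /l2norm big1 ?sqrtr0 // => i _; rewrite mxE expr0n.
apply/card_gt0P; exists (of_coord (fun=> 0)); rewrite inE.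
rewrite (_ : coord _ = fun=> 0) //; apply/funext => i; exact: of_coordK.
Qed.

Lemma exists_centers_of_mesh :
  exists (G : finType) (Y : {set G}) (c : G -> 'cV[R]_d),
  (0 < #|Y|)%N /\ forall x, l2norm x <= 1 ->
  (5 ^ d * #|Y| <=
     2 * 13 ^ d * #|[set g in Y | (l2norm (x - c g) <= 44 / 100)%R]%SET|)%N.
Proof.
exists grid, ball_grid, center; split; last exact: card_near_center.
exact: ball_grid_gt0.
Qed.

End Grid.

Lemma exists_centers (R : realType) (d : nat) : (0 < d)%N ->
  exists (G : finType) (Y : {set G}) (c : G -> 'cV[R]_d),
  (0 < #|Y|)%N /\ forall x, l2norm x <= 1 ->
  (5 ^ d * #|Y| <=
     2 * 13 ^ d * #|[set g in Y | (l2norm (x - c g) <= 44 / 100)%R]%SET|)%N.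
Proof.
move=> d_gt0; apply: (@exists_centers_of_mesh _ _ (220 * d) (200 * d%:R)) => //.
by rewrite natrM.
Qed.

(** * Few clusters for points of the unit ball *)

(** The value 2.65 exceeds both [13 / 5], needed for the count, and [3 * 0.88 = 2.64], needed for
    the diameter. *)
Lemma expR1_lower (R : realType) : 265 / 100 <= expR 1 :> R.
Proof.
have e20 : expR 1 = expR (20^-1) ^+ 20 :> R.
  by rewrite -expRM_natl mulfV ?pnatr_eq0.
have base_ge0 : 0 <= 21 / 20 :> R by lra.
rewrite e20; apply: (@le_trans _ _ ((21 / 20) ^+ 20)); first lra.
rewrite lerXn2r ?nnegrE ?expR_ge0 //.
by apply: le_trans (expR_ge1Dx _); lra.
Qed.

Lemma clusterable_unit_ball (R : realType) (n d : nat) (x : 'I_n -> 'cV[R]_d) :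
  (0 < n)%N -> (0 < d)%N -> (forall i, l2norm (x i) <= 1) ->
  exists m, [/\ (0 < m)%N, m%:R <= 2 * expR d%:R * ln n%:R + 1 :> R &
                clusterable m (expR 1 / 3) x].
Proof.
move=> n_gt0 d_gt0 x_le1.
have [G [Y [c [Y_gt0 dense]]]] := exists_centers R d_gt0.
pose cov g := [set i | l2norm (x i - c g) <= 44 / 100]%SET.
pose p : R := 2^-1 * (5 / 13) ^+ d.
have p_gt0 : 0 < p by rewrite mulr_gt0 ?exprn_gt0 //; lra.
have p_le1 : p <= 1.
  have : (5 / 13) ^+ d <= 1 :> R by rewrite exprn_ile1 //; lra.
  by rewrite /p; lra.
have cov_dense i : p * #|Y|%:R <= #|[set g in Y | i \in cov g]%SET|%:R.
  have -> : [set g in Y | i \in cov g]%SET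
      = [set g in Y | l2norm (x i - c g) <= 44 / 100]%SET.
    by apply/setP => g; rewrite !inE.
  have := dense (x i) (x_le1 i); rewrite -(ler_nat R) !natrM !natrX => dense_i.
  rewrite /p expr_div_n -mulrA mulrAC ler_pdivrMl // ler_pdivrMr ?exprn_gt0 //.
  by rewrite mulrAC.
have [|P [partP cardP covP]] := greedy_partition p_gt0 p_le1 Y_gt0 cov_dense.
  by rewrite card_ord.
exists #|P|; split.
- rewrite card_gt0; apply/eqP => P0.
  have := cover_partition partP; rewrite P0 /finset.cover big_set0.
  by move/setP/(_ (Ordinal n_gt0)); rewrite !inE.
- apply: le_trans cardP _; rewrite card_ord lerD2r mulrC.
  rewrite ler_wpM2r ?ln_ge0 ?ler1n //.
  (* Here [1 / p = 2 * (13 / 5) ^ d], and [13 / 5] is below [e]. *)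
  rewrite /p invfM invrK -exprVn invf_div ler_pM2l // -(mulr1 d%:R) expRM_natl.
  by rewrite lerXn2r ?nnegrE ?expR_ge0 //; have := expR1_lower R; lra.
- exists P; split=> // C /covP[g /fintype.subsetP Cg] i j /Cg + /Cg.
  rewrite !inE => xi xj.
  have -> : x i - x j = (x i - c g) + - (x j - c g).
    by rewrite opprB addrA subrK.
  apply: le_trans (l2normD _ _) _; rewrite l2normN.
  have := expR1_lower R; move: xi xj; move: (l2norm _) (l2norm _) => a b; lra.
Qed.

(** * Asymptotics and the space bound *)

Lemma near_expR_le_lnX (R : realType) (r : nat -> R) (a : R) :
  0 <= a -> r =O_\oo (fun n => ln (ln (n%:R : R))) ->
  exists K : nat, \forall n \near \oo,
    1 <= ln (n%:R : R) /\ expR (a * r n) <= ln n%:R ^+ K.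
Proof.
move=> a0 /eqO_exP[b b0 rb].
(* From [r n <= b * ln (ln n)] the exponential is at most [ln n] to the power [a * b]; this exponent
   may be rounded up once [ln n >= 1]. *)
exists (Num.truncn (a * b)).+1; near=> n.
have ln1 : 1 <= ln (n%:R : R).
  rewrite -[leLHS](expRK (R:=R)) ler_ln ?posrE ?expR_gt0 //; last first.
    apply: lt_le_trans (expR_gt0 1) _; near: n; exact: nbhs_infty_ger.
  by near: n; exact: nbhs_infty_ger.
split => //.
have lnln0 : 0 <= ln (ln (n%:R : R)) by rewrite ln_ge0.
have ln0 : 0 < ln (n%:R : R) by apply: lt_le_trans ln1.
rewrite -[leRHS](lnK (R:=R)) ?posrE ?exprn_gt0 // ler_expR lnXn //.
rewrite -[leRHS]mulr_natl.
have rn : `|r n| <= b * ln (ln n%:R).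
  by rewrite -[X in _ * X](ger0_norm lnln0); near: n.
apply: (@le_trans _ _ (a * (b * ln (ln n%:R)))).
  by rewrite ler_wpM2l // (le_trans (ler_norm _)).
by rewrite mulrA ler_wpM2r // ltW // truncnS_gt.
Unshelve. all: by end_near. Qed.

(** In [4 = 1 + 3], the 1 absorbs the lone [D] and the 3 comes from [m <= 3 * E * l]. The two extra
    powers of [l] come from [m] and from the explicit factor [l]. *)
Lemma space_bound_le (R : realType) (C e D E l X : R) (m : nat) (K : nat) :
  0 < e -> 1 <= D <= E -> 1 <= l -> m%:R <= 2 * E * l + 1 -> 0 <= X <= l ^+ K ->
  C * (D * e ^- 2 * (D + m%:R * X * l))
  <= 4 * `|C| * e ^- 2 * (D * E * l ^+ K.+2).
Proof.
move=> e0 /andP[D1 DE] l1 mE /andP[X0 Xl].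
have D0 : 0 <= D by lra.
have E1 : 1 <= E by lra.
have e2 : 0 <= e ^- 2 by rewrite invr_ge0 sqr_ge0.
have sum0 : 0 <= D + m%:R * X * l by rewrite addr_ge0 // !mulr_ge0 //; lra.
apply: (@le_trans _ _ (`|C| * (D * e ^- 2 * (D + m%:R * X * l)))).
  by rewrite ler_wpM2r ?ler_norm // !mulr_ge0.
have -> : 4 * `|C| * e ^- 2 * (D * E * l ^+ K.+2)
   = `|C| * (D * e ^- 2 * (4 * (E * l ^+ K.+2))) by ring.
rewrite ler_wpM2l // ler_wpM2l ?mulr_ge0 //.
have l0 : 0 <= l by lra.
have El : E <= E * l ^+ K.+2 by rewrite ler_peMr ?exprn_ege1 //; lra.
have mXl : m%:R * X * l <= 3 * (E * l ^+ K.+2).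
  have -> : 3 * (E * l ^+ K.+2) = (3 * E * l) * l ^+ K * l.
    by rewrite !exprS; ring.
  rewrite ler_wpM2r // ler_pM // (le_trans mE) //.
  have : 1 <= E * l by rewrite -[leLHS]mulr1 ler_pM.
  by lra.
by lra.
Qed.

Theorem theorem15 (R : realType) (SubGen : alg_family R)
    (d : nat -> nat) (r : nat -> R) :
  SubGen_guarantee SubGen ->
  (forall n, (2 <= d n)%N) ->
  (fun n => (d n)%:R : R) =o_\oo (fun n => ln (n%:R : R)) ->
  r =O_\oo (fun n => ln (ln (n%:R : R))) ->
  (exists (k : nat) (C : R -> R),
     \forall n \near \oo, forall (eps : R) (s : n.-tuple (token R (d n))),
       0 < eps -> admissible (r n) s ->
       uses_space (SubGen n (d n) eps (expR 1 / 3) (r n)) s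
         (C eps * ((d n)%:R * expR (d n)%:R * ln n%:R ^+ k))) /\
  (forall (n : nat) (eps : R) (s : n.-tuple (token R (d n))),
     (0 < n)%N -> 0 < eps -> admissible (r n) s ->
     accurate (SubGen n (d n) eps (expR 1 / 3) (r n)) s eps).
Proof.
move=> [C guarantee] d_ge2 _ rO.
have d_gt0 n : (0 < d n)%N by apply: ltn_trans (d_ge2 n).
have delta_gt0 : 0 < expR 1 / 3 :> R by rewrite divr_gt0 ?expR_gt0.
have run n (eps : R) (s : n.-tuple (token R (d n))) :
    (0 < n)%N -> 0 < eps -> admissible (r n) s ->
    exists m : nat, [/\ m%:R <= 2 * expR (d n)%:R * ln n%:R + 1 :> R,
      uses_space (SubGen n (d n) eps (expR 1 / 3) (r n)) s
        (C * ((d n)%:R * eps ^- 2 * ((d n)%:R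
           + m%:R * expR (2 * (expR 1 / 3) * r n) * ln n%:R))) &
      accurate (SubGen n (d n) eps (expR 1 / 3) (r n)) s eps].
  move=> n_gt0 eps_gt0 s_adm.
  (* [m] may vary with the stream, since [SubGen] is not given it. *)
  have [i|m [m_gt0 m_le cl]] := clusterable_unit_ball
    (x := fun i => key (tnth s i)) n_gt0 (d_gt0 n).
    by case: (s_adm i).
  have [|space acc] := guarantee _ _ m eps _ (r n) s n_gt0 (d_gt0 n) m_gt0
    eps_gt0 delta_gt0 cl.
    by move=> i; case: (s_adm i).
  by exists m.
split; last by move=> n eps s n_gt0 e0 /(run n eps s n_gt0 e0)[m []].
have [K nearK] := near_expR_le_lnX (mulr_ge0 (ler0n R 2) (ltW delta_gt0)) rO.
exists K.+2, (fun eps => 4 * `|C| * eps ^- 2).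
near=> n => eps s eps_gt0 s_adm.
have n_gt0 : (0 < n)%N by near: n; exact: nbhs_infty_gt.
have [ln1 exp_le] : 1 <= ln (n%:R : R) /\
    expR (2 * (expR 1 / 3) * r n) <= ln n%:R ^+ K by near: n.
have [m [m_le space _]] := run n eps s n_gt0 eps_gt0 s_adm.
move=> w i i_le; apply: le_trans (space w i i_le) _.
apply: space_bound_le => //; last by rewrite expR_ge0.
rewrite ler1n d_gt0 /=; apply: le_trans (expR_ge1Dx _); lra.
Unshelve. all: by end_near. Qed.
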